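(* Let $s\in(0,1)$, $N\ge1$, and let $f:\mathbb{R}\to\mathbb{R}$ be locally Lipschitz with $f>0$ in $(0,+\infty)$ and $$\liminf_{t\to0^+}\frac{f(t)}{t}>0.$$ Then the problem $$(-\Delta)^su=f(u)\ \text{ in }\mathbb{R}^N_+,\qquad u=0\ \text{ in }\mathbb{R}^N\setminus\mathbb{R}^N_+$$ does not admit any positive, bounded solution.
   Context: $\mathbb{R}^N_+=\{x=(x',x_N)\in\mathbb{R}^N: x_N>0\}$. The fractional Laplacian on $\mathbb{R}^N$ is $(-\Delta)^su(x)=c(N,s)\,\mathrm{P.V.}\!\int_{\mathbb{R}^N}\frac{u(x)-u(y)}{|x-y|^{N+2s}}\,dy$ with $c(N,s)=4^ss(1-s)\pi^{-N/2}\frac{\Gamma(s+\frac N2)}{\Gamma(2-s)}$. Solutions are classical: continuous on $\mathbb{R}^N$, regular enough in $\mathbb{R}^N_+$ (locally $C^{2s+\beta}$ for some $\beta>0$) for the principal value integral to make sense pointwise, with the equation holding at every point of $\mathbb{R}^N_+$. A solution is positive if $u>0$ in $\mathbb{R}^N_+$. *)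

(* Defs.v *)
From HB Require Import structures.
From mathcomp Require Import all_boot all_order all_algebra.
From mathcomp Require Import all_classical all_reals all_analysis.

Set Implicit Arguments.
Unset Strict Implicit.
Unset Printing Implicit Defensive.

Import Order.TTheory GRing.Theory Num.Theory.
Import numFieldNormedType.Exports.

Local Open Scope classical_set_scope.
Local Open Scope ring_scope.

(** Lebesgue measure on [R^n] lives on [n.-tuple R] with the product (= Borel) sigma-algebra, and is
    the [n]-fold product of [lebesgue_measure]; the base case [R^0] is a point of
    mass 1. [lebesgue_tuple_box] checks its value on boxes. *)

Section lebesgue_tuple.
Variable R : realType.
Local Notation RR := (measurableTypeR R).

Definition tuple_cons n (p : RR * n.-tuple RR) : n.+1.-tuple RR :=
  [the n.+1.-tuple RR of p.1 :: p.2].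

Definition tuple_uncons n (t : n.+1.-tuple RR) : RR * n.-tuple RR :=
  (thead t, [tuple of behead t]).

Lemma tuple_consK n : cancel (@tuple_cons n) (@tuple_uncons n).
Proof.
by case=> x t; rewrite /tuple_uncons /=; congr pair; apply: val_inj.
Qed.

Lemma measurable_tuple_cons n : measurable_fun setT (@tuple_cons n).
Proof. by apply: measurable_cons. Qed.

Lemma measurable_tuple_uncons n : measurable_fun setT (@tuple_uncons n).
Proof.
apply/measurable_fun_pairP; split.
  exact: (@measurable_tnth _ RR _ ord0).
exact: (@measurable_behead _ RR).
Qed.

Definition dirac_tuple0 : set (0.-tuple RR) -> \bar R :=
  dirac ([tuple] : 0.-tuple RR).

HB.instance Definition _ := Measure.on dirac_tuple0.

Let dirac_tuple0_sigma_finite : sigma_finite setT dirac_tuple0.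
Proof.
exists (fun=> setT) => [|i]; first by rewrite bigcup_const.
split; first exact: measurableT.
by rewrite /dirac_tuple0 diracT ltry.
Qed.

HB.instance Definition _ := Measure_isSigmaFinite.Build _ _ _ dirac_tuple0
  dirac_tuple0_sigma_finite.

Section step.
Variables (n : nat) (m : {sigma_finite_measure set (n.-tuple RR) -> \bar R}).

Definition cons_measure : set (n.+1.-tuple RR) -> \bar R :=
  pushforward (@lebesgue_measure R \x m)%E (@tuple_cons n).

Let cons_measure0 : cons_measure set0 = 0%E.
Proof. by rewrite /cons_measure /pushforward preimage_set0 measure0. Qed.

Let cons_measure_ge0 A : (0 <= cons_measure A)%E.
Proof. by rewrite /cons_measure /pushforward measure_ge0. Qed.

Let cons_measure_sigma_additive : semi_sigma_additive cons_measure.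
Proof.
move=> F mF tF mUF; rewrite /cons_measure /pushforward preimage_bigcup.
have mc := @measurable_tuple_cons n.
apply: measure_semi_sigma_additive.
- by move=> k; rewrite -[X in measurable X]setTI; exact: mc.
- apply/trivIsetP => /= i j _ _ ij; rewrite -preimage_setI.
  by move/trivIsetP : tF => /(_ _ _ _ _ ij) ->//; rewrite preimage_set0.
- by rewrite -preimage_bigcup -[X in measurable X]setTI; exact: mc.
Qed.

HB.instance Definition _ := isMeasure.Build _ _ _ cons_measure
  cons_measure0 cons_measure_ge0 cons_measure_sigma_additive.

Let cons_measure_sigma_finite : sigma_finite setT cons_measure.
Proof.
have /sigma_finiteP[F [FT ndF Foo]] := sigma_finiteT (@lebesgue_measure R).
have /sigma_finiteP[G [GT ndG Goo]] := sigma_finiteT m.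
exists (fun k => @tuple_uncons n @^-1` (F k `*` G k)) => [|k].
  rewrite -preimage_bigcup [X in _ @^-1` X](_ : _ = setT) ?preimage_setT//.
  apply/seteqP; split => // -[x y] _.
  have [i _ Fx] : (\bigcup_i F i) x by rewrite -FT.
  have [j _ Gy] : (\bigcup_i G i) y by rewrite -GT.
  exists (maxn i j) => //; split.
    by move: x Fx; exact/subsetPset/ndF/leq_maxl.
  by move: y Gy; exact/subsetPset/ndG/leq_maxr.
have [mF Fk] := Foo k; have [mG Gk] := Goo k; split.
  rewrite -[X in measurable X]setTI; apply: measurable_tuple_uncons => //.
  exact: measurableX.
rewrite /cons_measure /pushforward -comp_preimage.
rewrite (_ : _ \o _ = id) ?preimage_id; last exact/funext/tuple_consK.
by rewrite product_measure1E// lte_mul_pinfty// ge0_fin_numE.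
Qed.

HB.instance Definition _ := Measure_isSigmaFinite.Build _ _ _ cons_measure
  cons_measure_sigma_finite.

End step.

Fixpoint lebesgue_tuple n : {sigma_finite_measure set (n.-tuple RR) -> \bar R} :=
  if n is n'.+1 then cons_measure (lebesgue_tuple n') else dirac_tuple0.

Lemma lebesgue_tuple_box n (A : 'I_n -> set RR) :
  (forall i, measurable (A i)) ->
  lebesgue_tuple n [set t | forall i, A i (tnth t i)] =
  (\prod_(i < n) @lebesgue_measure R (A i))%E.
Proof.
elim: n A => [|n IH] A mA.
  rewrite big_ord0 /= /dirac_tuple0 diracE mem_set//= => -[] //.
rewrite big_ord_recl /= /cons_measure /pushforward.
rewrite -IH; last by move=> i; exact: mA.
rewrite -product_measure1E//; last first.
  rewrite (_ : [set t | _] = \bigcap_(i in [set: 'I_n])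
      ((fun t => tnth t i) @^-1` A (lift ord0 i))); last first.
    by apply/seteqP; split => t /= h i; [move=> _|]; exact: h.
  apply: fin_bigcap_measurable => // i _.
  by rewrite -[X in measurable X]setTI; exact: measurable_tnth.
congr (_ _); apply/seteqP; split => -[x t] /=.
  move=> h; split; first by have := h ord0; rewrite tnth0.
  by move=> i; have := h (lift ord0 i); rewrite tnthS.
move=> [h0 h] i; case: (unliftP ord0 i) => [j|] ->; last by rewrite tnth0.
by rewrite tnthS; exact: h.
Qed.

End lebesgue_tuple.

(** The library norm on ['rV[R]_n] is the sup norm: it induces the right
    topology, but every metric quantity below uses the Euclidean norm. *)

Section euclidean.
Variables (R : realType) (n : nat).
Implicit Types (x : 'rV[R]_n) (u : 'rV[R]_n -> R).

Definition row_of_tuple (t : n.-tuple (measurableTypeR R)) : 'rV[R]_n :=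
  \row_i tnth t i.

Definition enorm x : R := Num.sqrt (\sum_(i < n) x 0 i ^+ 2).

(** For [Omega] open: all partial derivatives of [u] of order at most [k] exist
    in [Omega], and those of order [k] are [gamma]-Hoelder near each point of
    [Omega]; this makes the lower-order ones continuous. *)
Fixpoint locally_Ck_holder (k : nat) (gamma : R) (Omega : set 'rV[R]_n) u :
    Prop :=
  if k is k'.+1 then
    forall i : 'I_n,
      (forall x, Omega x -> derivable u x (delta_mx 0 i)) /\
      locally_Ck_holder k' gamma Omega (fun x => 'D_(delta_mx 0 i) u x)
  else
    forall x, Omega x -> exists C : R, exists2 V, nbhs x V &
      forall y z, V y -> V z -> `|u y - u z| <= C * enorm (y - z) `^ gamma.

(** [C^alpha] means [C^{k,gamma}] with [alpha = k + gamma], [0 < gamma <= 1]. *)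
Definition locally_C (alpha : R) (Omega : set 'rV[R]_n) u : Prop :=
  exists k : nat, exists gamma : R,
    [/\ 0 < gamma <= 1, alpha = k%:R + gamma &
        locally_Ck_holder k gamma Omega u].

End euclidean.

(** Euler's integral, meaningful for [0 < z] only. *)
Definition Gamma (R : realType) (z : R) : R :=
  \int[@lebesgue_measure R]_(t in `]0, +oo[) (t `^ (z - 1) * expR (- t)).

Section fractional_laplacian.
Variables (R : realType) (n : nat) (s : R).
Implicit Types (x : 'rV[R]_n) (u : 'rV[R]_n -> R).

Definition cNs : R :=
  4 `^ s * s * (1 - s) * pi `^ (- (n%:R / 2))
  * (Gamma (s + n%:R / 2) / Gamma (2 - s)).

Definition frac_kernel u x (t : n.-tuple (measurableTypeR R)) : R :=
  (u x - u (row_of_tuple t)) / enorm (x - row_of_tuple t) `^ (n%:R + 2 * s).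

Definition far x (e : R) : set (n.-tuple (measurableTypeR R)) :=
  [set t | e < enorm (x - row_of_tuple t)].

Definition truncated u x (e : R) : R :=
  \int[lebesgue_tuple R n]_(t in far x e) frac_kernel u x t.

(** Integrability is required because [truncated], hence the limit, has a junk
    value otherwise. *)
Definition frac_laplacian_defined u x : Prop :=
  (forall e : R, 0 < e ->
     (lebesgue_tuple R n).-integrable (far x e) (EFin \o frac_kernel u x)) /\
  cvg (truncated u x e @[e --> 0^'+]).

Definition frac_laplacian u x : R :=
  cNs * lim (truncated u x e @[e --> 0^'+]).

End fractional_laplacian.

(** The dimension is [N = n.+1], and [x_N] is the coordinate [x 0 ord_max]. *)

Definition half_space (R : realType) (n : nat) : set 'rV[R]_n.+1 :=
  [set x | 0 < x 0 ord_max].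
Arguments half_space : clear implicits.

Definition classical_solution (R : realType) (n : nat) (s : R) (f : R -> R)
    (u : 'rV[R]_n.+1 -> R) : Prop :=
  [/\ continuous u,
      exists2 beta : R, 0 < beta & locally_C (2 * s + beta) (half_space R n) u,
      forall x, half_space R n x ->
        frac_laplacian_defined s u x /\ frac_laplacian s u x = f (u x) &
      forall x, ~ half_space R n x -> u x = 0].

Definition positive_solution (R : realType) (n : nat) (s : R) (f : R -> R)
    (u : 'rV[R]_n.+1 -> R) : Prop :=
  classical_solution s f u /\ (forall x, half_space R n x -> 0 < u x).

(* Main.v *)
From HB Require Import structures.
Require Import Defs.
From mathcomp Require Import all_boot all_order all_algebra.
From mathcomp Require Import all_classical all_reals all_analysis.
From mathcomp Require Import measurable_realfun ring lra.
Set Implicit Arguments.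
Unset Strict Implicit.
Unset Printing Implicit Defensive.
Import Order.TTheory GRing.Theory Num.Theory.
Import numFieldNormedType.Exports.
Local Open Scope classical_set_scope.
Local Open Scope ring_scope.

(** The nonlinearity only matters through the bound [f t >= l * t] on the range
    of [u], with some [l > 0]: near [0] this is the hypothesis on the lower
    limit, and away from [0] it is compactness. A positive bounded solution is
    thus a positive supersolution of [(-Delta)^s u = l u] in the half-space.
    Since the half-space contains balls of every radius [r], and the first
    eigenvalue of such a ball is of order [r^(-2s)], this is impossible.

    The eigenvalue bound is obtained by a touching argument instead of spectral
    theory. Let [B] be a ball of radius [r] and centre [c] whose closure lies in
    the half-space, and let [phi y = max(0, 1 - |c-y|^2/r^2)^2] ([pbump]). At a
    maximum point [x] of [phi / u] on [B], the function [phi(x) u - u(x) phi] is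
    nonnegative everywhere and vanishes at [x], so that
    [phi(x) (-Delta)^s u(x) <= u(x) (-Delta)^s phi(x)]. If moreover
    [(-Delta)^s phi <= C r^(-2s) phi] on [B], then
    [l u(x) <= f (u(x)) = (-Delta)^s u(x) <= C r^(-2s) u(x)], which is absurd for
    large [r].

    The inequality for [phi] ([truncated_pbump_le]) is proved for the truncated
    integrals, uniformly in the truncation. Write [P] for the paraboloid inside
    [phi] and take [rho = eta r].
    - For [|x-y| <= rho], convexity gives
      [phi(x) - phi(y) <= 2 P(x) (P(x) - P(y))]. The part of [P(x) - P(y)] that is
      linear in [y - x] is odd under the reflection of centre [x] and integrates
      to zero; the quadratic part contributes at most
      [C eta^(2-2s) P(x) r^(-2s)] ([pbump_near]).
    - For [|x-y| > rho] the term [phi(x)] contributes at most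
      [C eta^(-2s) phi(x) r^(-2s)], while the term [- phi(y)] is kept
      ([pbump_far]).
    - Near the sphere [P(x)] is much larger than [phi(x) = P(x)^2], so that the
      first contribution is not controlled by [phi(x)]. There the nonlocal term
      [- phi(y)] helps: it is at most [- c0 r^(-2s)] ([pbump_tail_ge]), and [eta]
      is chosen so small that it absorbs the first contribution.

    The integrals of [|h|^2 / |h|^(n+2s)] near the origin and of
    [1 / |h|^(n+2s)] at infinity are bounded by dyadic decomposition
    ([dyadic_radial_integral]), for which the measure of cubes suffices. *)

(** * Reflection invariance of Lebesgue measure *)

Section reflection.
Variable R : realType.
Local Notation RR := (measurableTypeR R).

Lemma measurable_reflectR (a : R) :
  measurable_fun setT ((fun y => a - y) : RR -> RR).
Proof. exact: measurable_funB. Qed.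

Lemma lebesgue_measure_reflect (a : R) (A : set RR) : measurable A ->
  pushforward (@lebesgue_measure R) ((fun y => a - y) : RR -> RR) A =
  lebesgue_measure A.
Proof.
move=> mA.
pose phi := ((fun y => a - y) : RR -> RR).
have mphi : measurable_fun setT phi by exact: measurable_reflectR.
pose phiM := isMeasurableFun.Build _ _ _ _ _ mphi.
pose phim : {mfun RR >-> RR} := HB.pack phi phiM.
pose nu := pushforward lebesgue_measure phim.
apply/esym/(lebesgue_measure_unique (mu := nu)) => //= _ [[b c]] _ <-.
rewrite /nu/=.
rewrite /pushforward.
rewrite (_ : _ @^-1` _ = [set` `[a - c, a - b[%R]); last first.
  apply/seteqP; split => y /=; rewrite !in_itv/= /phi => /andP[h1 h2].
    by apply/andP; split; lra.
  by apply/andP; split; lra.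
rewrite !lebesgue_measure_itv/= !lte_fin ltrD2l ltrN2; case: ifP => // _.
by rewrite -!EFinB; congr EFin; ring.
Qed.

Definition tuple_reflect n (a : 'I_n -> R) (t : n.-tuple RR) : n.-tuple RR :=
  [tuple (a i - tnth t i : RR) | i < n].

Lemma measurable_tuple_reflect n (a : 'I_n -> R) :
  measurable_fun setT (tuple_reflect a).
Proof.
apply/measurable_fun_tnthP => i.
rewrite (_ : _ \o _ = (fun t => a i - tnth t i)); last first.
  by apply/funext => t /=; rewrite tnth_mktuple.
by apply: (measurableT_comp (measurable_reflectR (a i))); exact: measurable_tnth.
Qed.

(** By induction on the dimension: both measures are products, and they agree on
    rectangles by the one-dimensional case and the induction hypothesis. *)
Lemma lebesgue_tuple_reflect n (a : 'I_n -> R) (A : set (n.-tuple RR)) :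
  measurable A ->
  pushforward (lebesgue_tuple R n) (tuple_reflect a) A = lebesgue_tuple R n A.
Proof.
elim: n a A => [|n IH] a A mA.
  rewrite /pushforward (_ : tuple_reflect a = id)// ?preimage_id//.
  by apply/funext => t; rewrite tuple0 [RHS]tuple0.
pose phi1 := ((fun y => a ord0 - y) : RR -> RR).
pose phi2 := tuple_reflect (fun i => a (lift ord0 i)).
pose phi (p : RR * n.-tuple RR) := (phi1 p.1, phi2 p.2).
have mphi : measurable_fun setT phi.
  apply/measurable_fun_pairP; split => /=.
    by apply: (measurableT_comp (measurable_reflectR (a ord0))).
  by apply: (measurableT_comp (measurable_tuple_reflect _)).
pose phiM := isMeasurableFun.Build _ _ _ _ _ mphi.
pose phim : {mfun (RR * n.-tuple RR)%type >-> (RR * n.-tuple RR)%type} :=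
  HB.pack phi phiM.
have phiE : @tuple_reflect n.+1 a \o @tuple_cons R n = @tuple_cons R n \o phi.
  apply/funext => -[y t] /=; apply: eq_from_tnth => i.
  rewrite tnth_mktuple; case: (unliftP ord0 i) => [j|] ->.
    by rewrite !tnthS tnth_mktuple.
  by rewrite !tnth0.
rewrite /= /cons_measure /pushforward -comp_preimage phiE comp_preimage.
pose nu := pushforward (@lebesgue_measure R \x lebesgue_tuple R n)%E phim.
rewrite [RHS](@product_measure_unique _ _ _ _ _ _ _ nu)//.
- move=> B C mB mC; rewrite /nu/= /pushforward/=.
  rewrite (_ : phi @^-1` _ = (phi1 @^-1` B) `*` (phi2 @^-1` C))//.
  rewrite product_measure1E//; last 2 first.
    rewrite -[X in measurable X]setTI; exact: measurable_reflectR.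
    rewrite -[X in measurable X]setTI; exact: measurable_tuple_reflect.
  by congr (_ * _)%E; [exact: lebesgue_measure_reflect|exact: IH].
- rewrite -[X in measurable X]setTI; exact: measurable_tuple_cons.
Qed.

End reflection.

(** * Euclidean distance to a point *)

Section euclidean_norm.
Variables (R : realType) (n : nat).
Implicit Types x y : 'rV[R]_n.

Lemma enorm_ge0 x : 0 <= enorm x.
Proof. exact: sqrtr_ge0. Qed.

Lemma enorm_sqr x : enorm x ^+ 2 = \sum_(i < n) x 0 i ^+ 2.
Proof. by rewrite /enorm sqr_sqrtr// sumr_ge0// => i _; exact: sqr_ge0. Qed.

Lemma enorm_parallelogram x y :
  enorm (x + y) ^+ 2 + enorm (x - y) ^+ 2 = 2 * enorm x ^+ 2 + 2 * enorm y ^+ 2.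
Proof.
rewrite !enorm_sqr !mulr_sumr -!big_split/=; apply: eq_bigr => i _.
by rewrite !mxE; ring.
Qed.

(** A triangle inequality for squared norms, the form in which distances are
    compared below. *)
Lemma enormD_sqr_le x y :
  enorm (x + y) ^+ 2 <= 2 * enorm x ^+ 2 + 2 * enorm y ^+ 2.
Proof. by rewrite -enorm_parallelogram lerDl sqr_ge0. Qed.

Lemma enormN x : enorm (- x) = enorm x.
Proof. by congr Num.sqrt; apply: eq_bigr => i _; rewrite mxE sqrrN. Qed.

Lemma normr_coord_le_enorm x i : `|x 0 i| <= enorm x.
Proof.
rewrite -sqrtr_sqr ler_wsqrtr// (bigD1 i)//= lerDl.
by rewrite sumr_ge0// => j _; exact: sqr_ge0.
Qed.

Lemma continuous_enorm_sqr (c : 'rV[R]_n) :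
  continuous (fun x : 'rV[R]_n => enorm (x - c) ^+ 2).
Proof.
rewrite (_ : (fun x => _) = (fun x => \sum_(i < n) (x 0 i - c 0 i) ^+ 2)).
  apply: continuous_big => [|i _ x /=]; first exact: add_continuous.
  apply: (@continuous_comp _ _ _ (fun x : 'rV[R]_n => x 0 i - c 0 i)
    (fun y : R => y ^+ 2)); last exact: exprn_continuous.
  apply: (@continuousB _ _ _ (fun x : 'rV[R]_n => x 0 i) (fun=> c 0 i)).
    exact: coord_continuous.
  exact: cst_continuous.
by apply/funext => x; rewrite enorm_sqr; apply: eq_bigr => i _; rewrite !mxE.
Qed.

End euclidean_norm.

Section distance_to_a_point.
Variables (R : realType) (n : nat).
Local Notation mu := (lebesgue_tuple R n).
Local Notation RR := (measurableTypeR R).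
Implicit Types (x : 'rV[R]_n) (t : n.-tuple RR).

Definition dist x t : R := enorm (x - row_of_tuple t).

Lemma dist_ge0 x t : 0 <= dist x t. Proof. exact: enorm_ge0. Qed.

Lemma measurable_dist x : measurable_fun setT (dist x).
Proof.
have msqrt : measurable_fun setT (@Num.sqrt R).
  by apply: continuous_measurable_fun; exact: sqrt_continuous.
apply: (measurableT_comp msqrt) => /=.
apply: measurable_sum => i; apply: measurable_funX.
rewrite (_ : (fun t => _) = (fun t => x 0 i - tnth t i)).
  by apply: (measurableT_comp (measurable_reflectR (x 0 i))); exact: measurable_tnth.
by apply/funext => t; rewrite !mxE.
Qed.

Lemma measurable_dist_set x (A : set R) : measurable A -> measurable (dist x @^-1` A).
Proof. by move=> mA; rewrite -[X in measurable X]setTI; exact: measurable_dist. Qed.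

Lemma lebesgue_tuple_cube x d : 0 <= d ->
  mu [set t | forall i, `|x 0 i - tnth t i| <= d] = ((2 * d) ^+ n)%:E.
Proof.
move=> d0.
rewrite (_ : [set t | _] =
    [set t | forall i, `[x 0 i - d, x 0 i + d]%classic (tnth t i)]).
  rewrite (@lebesgue_tuple_box R n (fun i => `[x 0 i - d, x 0 i + d]%classic))//.
  under eq_bigr => i _.
    rewrite lebesgue_measure_itv/= lte_fin.
    rewrite (_ : (if _ then _ else _) = (2 * d)%:E); last first.
      case: ifPn => [_|]; first by rewrite -EFinB; congr EFin; ring.
      by rewrite -leNgt => h; congr EFin; lra.
    over.
  by rewrite prodEFin prodr_const card_ord.
apply/seteqP; split => t /= h i; have := h i; 
  by rewrite in_itv/= ler_norml => /andP[? ?]; apply/andP; split; lra.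
Qed.

Lemma measurable_cube x d : measurable [set t | forall i, `|x 0 i - tnth t i| <= d].
Proof.
rewrite (_ : [set t | _] = \bigcap_(i in [set: 'I_n])
    ((fun t => x 0 i - tnth t i) @^-1` [set y | `|y| <= d])); last first.
  by apply/seteqP; split => t /= h i; [move=> _|]; exact: h.
apply: fin_bigcap_measurable => // i _.
rewrite -[X in measurable X]setTI.
apply: (measurableT_comp (measurable_reflectR (x 0 i))) => //.
  exact: measurable_tnth.
rewrite (_ : [set y | _] = `[-d, d]%classic)//.
by apply/seteqP; split => y /=; rewrite in_itv/= ler_norml.
Qed.

Lemma lebesgue_tuple_ball_le x d : 0 <= d ->
  (mu [set t | dist x t <= d]%R <= ((2 * d) ^+ n)%:E)%E.
Proof.
move=> d0; rewrite -(lebesgue_tuple_cube x d0); apply: le_measure; rewrite ?inE.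
- rewrite (_ : [set t | _] = dist x @^-1` `]-oo, d]%classic).
    exact: measurable_dist_set.
  by apply/seteqP; split => t /=; rewrite in_itv.
- exact: measurable_cube.
- move=> t /= td i; apply: le_trans td; apply: le_trans (normr_coord_le_enorm _ i).
  by rewrite !mxE.
Qed.

End distance_to_a_point.

(** * Dyadic bounds for radial integrals *)

Section radial_integrals.
Variables (R : realType) (n : nat) (s : R).
Hypothesis s_gt0 : 0 < s.
Local Notation mu := (lebesgue_tuple R n).
Local Notation RR := (measurableTypeR R).
Implicit Types (x : 'rV[R]_n) (t : n.-tuple RR).

(** [j = 0] is the kernel of the operator, and [j = 2] is its product with the
    quadratic remainder of a second-order expansion. *)
Definition radial (j : nat) x t : R :=
  dist x t ^+ j / dist x t `^ (n%:R + 2 * s).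

Lemma radial_ge0 j x t : 0 <= radial j x t.
Proof. by rewrite divr_ge0 ?exprn_ge0 ?dist_ge0 ?powR_ge0. Qed.

Lemma measurable_radial j x : measurable_fun setT (radial j x).
Proof.
apply: measurable_funM; first by apply: measurable_funX; exact: measurable_dist.
rewrite (_ : (fun t => _) = (fun t => dist x t `^ (- (n%:R + 2 * s)))).
  by apply: (measurableT_comp (measurable_powR _)); exact: measurable_dist.
by apply/funext => t; rewrite -powRN.
Qed.

(** On the shell [rho b^k < |x-t| <= 2 rho b^k] the integrand is at most a
    multiple of [(rho b^k)^(j-n-2s)], and the shell lies in a cube of measure
    [(4 rho b^k)^n]. The contributions form a geometric series of ratio
    [b^(j-2s)]. The two useful cases are [b = 2] with [j = 0], and [b = 1/2] with
    [j = 2]. *)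
Lemma dyadic_radial_integral (j : nat) (b : R) : 0 < b ->
  b `^ (j%:R - 2 * s) < 1 ->
  exists2 C : R, 0 < C & forall x (rho : R) D, 0 < rho -> measurable D ->
    (forall t, D t -> exists k, rho * b ^+ k < dist x t <= 2 * (rho * b ^+ k)) ->
    (\int[mu]_(t in D) (radial j x t)%:E <= (C * rho `^ (j%:R - 2 * s))%:E)%E.
Proof.
move=> b0 b1; set g := j%:R - 2 * s in b1 *; set beta := b `^ g in b1.
have beta0 : 0 <= beta by exact: powR_ge0.
exists (2 ^+ j * 4 ^+ n / (1 - beta)).
  by rewrite divr_gt0 ?subr_gt0// mulr_gt0// exprn_gt0.
move=> x rho D rho0 mD Dcov.
pose r k := rho * b ^+ k.
have r0 k : 0 < r k by rewrite mulr_gt0// exprn_gt0.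
pose c k := (2 * r k) ^+ j / r k `^ (n%:R + 2 * s).
have c0 k : 0 <= c k by rewrite divr_ge0 ?powR_ge0// exprn_ge0// mulr_ge0// ltW.
pose B k := [set t | dist x t <= 2 * r k].
have mB k : measurable (B k).
  rewrite (_ : B k = dist x @^-1` `]-oo, 2 * r k]%classic).
    exact: measurable_dist_set.
  by apply/seteqP; split => t /=; rewrite in_itv.
(* the measure bound of the ball [B k], multiplied by the value [c k] *)
have cE k : c k * (2 * (2 * r k)) ^+ n = 2 ^+ j * 4 ^+ n * rho `^ g * beta ^+ k.
  have -> : beta ^+ k = (b ^+ k) `^ g.
    by rewrite -powR_mulrn// -powRrM mulrC powRrM powR_mulrn// ltW.
  rewrite -[RHS]mulrA -powRM ?exprn_ge0 ?(ltW b0) ?(ltW rho0)// -/(r k).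
  have -> : r k `^ g = r k ^+ j * r k ^+ n / r k `^ (n%:R + 2 * s).
    rewrite -!powR_mulrn ?(ltW (r0 k))// -powRN -!powRD ?(gt_eqF (r0 k)) ?implybT//.
    by congr (_ `^ _); rewrite /g; ring.
  rewrite /c (_ : 2 * (2 * r k) = 4 * r k); last by ring.
  by rewrite !exprMn; ring.
have f0 k t : (0 <= (c k * \1_(B k) t)%:E)%E.
  by rewrite lee_fin mulr_ge0.
have mf k : measurable_fun D (fun t => (c k * \1_(B k) t)%:E).
  apply/measurable_EFinP; apply: measurable_funM; first exact: measurable_cst.
  by apply: measurable_indic.
(* Dominating by a series of indicators of balls, instead of splitting [D] into
   the shells, avoids any disjointness argument. *)
apply: (@le_trans _ _ (\int[mu]_(t in D) (\sum_(k <oo) (c k * \1_(B k) t)%:E))%E).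
  apply: ge0_le_integral => //.
  - by move=> t _; rewrite lee_fin radial_ge0.
  - by apply/measurable_EFinP/measurable_funTS; exact: measurable_radial.
  - apply: ge0_emeasurable_sum => //.
  - move=> t /Dcov[k /andP[rd dr]].
    apply: (@le_trans _ _ (\sum_(0 <= i < k.+1) (c i * \1_(B i) t)%:E)%E); last first.
      exact: nneseries_lim_ge.
    rewrite big_nat_recr//=; apply: (@le_trans _ _ (c k * \1_(B k) t)%:E); last first.
      by rewrite leeDr// sume_ge0.
    rewrite indicE mem_set//= mulr1 lee_fin /radial /c.
    apply: ler_pM; rewrite ?exprn_ge0 ?dist_ge0 ?invr_ge0 ?powR_ge0//.
      by rewrite lerXn2r// nnegrE ?dist_ge0// mulr_ge0// ltW.
    rewrite lef_pV2 ?posrE ?powR_gt0 ?(lt_trans (r0 k) rd)//.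
    apply: ge0_ler_powR; rewrite ?nnegrE ?dist_ge0 ?(ltW (r0 k)) ?(ltW rd)//.
    by rewrite addr_ge0// mulr_ge0// ltW.
rewrite integral_nneseries//.
apply: lime_le; first by apply: is_cvg_nneseries => k _ _; exact: integral_ge0.
apply: nearW => m.
apply: (@le_trans _ _ (\sum_(0 <= k < m) (2 ^+ j * 4 ^+ n * rho `^ g * beta ^+ k)%:E)%E).
  apply: lee_sum => k _.
  under eq_integral do rewrite EFinM.
  rewrite ge0_integralZl//=; first last.
  - by rewrite lee_fin.
  - by apply/measurable_EFinP; apply: measurable_indic.
  rewrite integral_indic// -cE (EFinM (c k)) lee_pmul2l//=.
    apply: (@le_trans _ _ (mu (B k))).
      by apply: le_measure; rewrite ?inE//; exact: measurableI.
    by apply: lebesgue_tuple_ball_le; rewrite mulr_ge0// ltW.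
  by rewrite lte_fin divr_gt0 ?powR_gt0// exprn_gt0// mulr_gt0.
rewrite sumEFin lee_fin -mulr_sumr.
rewrite [leRHS](_ : _ = 2 ^+ j * 4 ^+ n * rho `^ g * (1 - beta)^-1); last by ring.
rewrite ler_wpM2l ?mulr_ge0 ?exprn_ge0 ?powR_ge0//.
have /(congr1 (@^~ m))/= := @geometric_seriesE R 1 beta (negbT (lt_eqF b1)).
rewrite /series/=; under eq_bigr do rewrite mul1r.
rewrite mul1r => ->.
by rewrite ler_piMl ?invr_ge0 ?subr_ge0 ?(ltW b1)// gerBl exprn_ge0.
Qed.

End radial_integrals.

(** * Integrals near a point and far from it *)

Section near_and_far.
Variables (R : realType) (n : nat) (s : R).
Hypothesis s01 : 0 < s < 1.
Local Notation mu := (lebesgue_tuple R n).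
Local Notation RR := (measurableTypeR R).
Implicit Types (x : 'rV[R]_n) (t : n.-tuple RR).

Let s_gt0 : 0 < s. Proof. by case/andP: s01. Qed.
Let s_lt1 : s < 1. Proof. by case/andP: s01. Qed.

Lemma exp2_unbounded (a : R) : exists k, a < 2 ^+ k.
Proof.
exists (Num.bound `|a|); apply: (le_lt_trans (ler_norm a)).
apply: (lt_trans (archi_boundP (normr_ge0 a))).
set k := Num.bound _; have : (k < 2 ^ k)%N by exact: ltn_expl.
by rewrite -(ltr_nat R) natrX.
Qed.

Lemma dyadic_above (a d : R) : 0 < a -> a < d ->
  exists k, a * 2 ^+ k < d <= 2 * (a * 2 ^+ k).
Proof.
move=> a0 ad.
have ex : exists k, d <= 2 * (a * 2 ^+ k).
  have [k kda] := exp2_unbounded (d / a); exists k.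
  have : 0 <= a * 2 ^+ k by rewrite mulr_ge0 ?exprn_ge0// ltW.
  by move: kda; rewrite ltr_pdivrMr// => kda; lra.
case: (ex_minnP ex) => k dk kmin; exists k; rewrite dk andbT.
case: k dk kmin => [|k] dk kmin; first by rewrite expr0 mulr1.
rewrite ltNge; apply/negP => h.
have /kmin : d <= 2 * (a * 2 ^+ k) by rewrite (le_trans h)// exprS; lra.
by rewrite ltnn.
Qed.

Lemma dyadic_below (a d : R) : 0 < d -> d <= a ->
  exists k, a * 2^-1 ^+ k < d <= 2 * (a * 2^-1 ^+ k).
Proof.
move=> d0 da; have a0 : 0 < a by exact: lt_le_trans da.
have ex : exists k, a * 2^-1 ^+ k < d.
  have [k h] := exp2_unbounded (a / d); exists k.
  by rewrite exprVn ltr_pdivrMr ?exprn_gt0// mulrC -ltr_pdivrMr.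
case: (ex_minnP ex) => k kd kmin; exists k; rewrite kd /=.
case: k kd kmin => [|k] kd kmin.
  by have := lt_le_trans kd da; rewrite expr0 mulr1 ltxx.
rewrite exprS (_ : 2 * _ = a * 2^-1 ^+ k); last by field.
by rewrite leNgt; apply/negP => /kmin; rewrite ltnn.
Qed.

Lemma measurable_far x rho : measurable (far x rho).
Proof.
rewrite (_ : far x rho = dist x @^-1` `]rho, +oo[%classic).
  exact: measurable_dist_set.
by apply/seteqP; split => t /=; rewrite in_itv/= andbT.
Qed.

Lemma measurable_annulus x a b : measurable [set t | a < dist x t <= b].
Proof.
rewrite (_ : mkset _ = dist x @^-1` `]a, b]%classic).
  exact: measurable_dist_set.
by apply/seteqP; split => t /=; rewrite in_itv.
Qed.

Lemma far_integral : exists2 C : R, 0 < C & forall x (rho : R), 0 < rho ->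
  (\int[mu]_(t in far x rho) (radial s 0 x t)%:E <=
   (C * rho `^ (- (2 * s)))%:E)%E.
Proof.
have b1 : (2 : R) `^ (0%:R - 2 * s) < 1.
  rewrite sub0r powRN invf_lt1 ?powR_gt0//.
  have := @gt0_ltr_powR R (2 * s) _ 1 2; rewrite powR1; apply; rewrite ?nnegrE//.
    by rewrite mulr_gt0.
  by rewrite ltr1n.
have [C C0 CP] := dyadic_radial_integral n s_gt0 (ltr0Sn R 1) b1.
exists C => // x rho rho0; rewrite -(sub0r (2 * s)) (_ : 0 = 0%:R)//.
apply: CP => //; first exact: measurable_far.
by move=> t tx; exact: dyadic_above.
Qed.

Lemma near_integral : exists2 C : R, 0 < C & forall x (rho : R), 0 < rho ->
  (\int[mu]_(t in [set t | 0 < dist x t <= rho]%R) (radial s 2 x t)%:E <=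
   (C * rho `^ (2 - 2 * s))%:E)%E.
Proof.
have b1 : (2^-1 : R) `^ (2%:R - 2 * s) < 1.
  have := @gt0_ltr_powR R (2%:R - 2 * s) _ 2^-1 1; rewrite powR1; apply.
  - by rewrite subr_gt0 gtr_pMr.
  - by rewrite nnegrE invr_ge0.
  - by rewrite nnegrE.
  - by rewrite invf_lt1// ltr1n.
have h : 0 < (2^-1 : R) by rewrite invr_gt0.
have [C C0 CP] := dyadic_radial_integral n s_gt0 h b1.
exists C => // x rho rho0; apply: CP => //; first exact: measurable_annulus.
by move=> t /andP[d0 dr]; exact: dyadic_below.
Qed.

(** This is how the principal value enters: the first-order term of the bump
    function is not absolutely integrable near [x] uniformly in the truncation
    when [s >= 1/2], but its truncated integrals vanish. *)
Lemma Rintegral_odd x D (g : n.-tuple RR -> R) : measurable D ->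
  (forall t, D (tuple_reflect (fun i => 2 * x 0 i) t) = D t) ->
  measurable_fun setT g ->
  mu.-integrable D (EFin \o g) ->
  (forall t, g (tuple_reflect (fun i => 2 * x 0 i) t) = - g t) ->
  \int[mu]_(t in D) g t = 0.
Proof.
move=> mD Dsym mg ig gN; set sg := tuple_reflect _ in Dsym gN.
have msg : measurable_fun setT sg by exact: measurable_tuple_reflect.
have DE : sg @^-1` D = D by apply/seteqP; split => t; rewrite /preimage/= Dsym.
have goE : (EFin \o g) \o sg = EFin \o (fun t => -1 * g t).
  by apply/funext => t /=; rewrite gN mulN1r.
have gE : \int[mu]_(t in D) g t = \int[mu]_(t in D) (-1 * g t).
  congr fine; have := @integral_pushforward _ _ _ _ R sg msg mu D (EFin \o g).
  rewrite goE DE => <-//; last 2 first.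
  - exact/measurable_EFinP.
  - exact: (integrableZl mD (-1) ig).
  by apply: eq_measure_integral => A mA _; apply/esym/lebesgue_tuple_reflect.
by move: gE; rewrite RintegralZl//; lra.
Qed.

End near_and_far.

(** * The bump function and its kernel near the point *)

Section bump.
Variables (R : realType) (n : nat) (s : R).
Hypothesis s01 : 0 < s < 1.
Local Notation mu := (lebesgue_tuple R n).
Local Notation RR := (measurableTypeR R).
Implicit Types (c x y : 'rV[R]_n) (t : n.-tuple RR).

Lemma radial0E x t : radial s 0 x t = (dist x t `^ (n%:R + 2 * s))^-1.
Proof. by rewrite /radial expr0 mul1r. Qed.

Lemma integrable_radial_far x rho : 0 < rho ->
  mu.-integrable (far x rho) (EFin \o radial s 0 x).
Proof.
move=> rho0; apply/integrableP; split.
  by apply/measurable_EFinP/measurable_funTS; exact: measurable_radial.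
have [C C0 CP] := far_integral n s01.
apply: le_lt_trans (ltry (C * rho `^ (- (2 * s)))).
apply: le_trans (CP x rho rho0); rewrite le_eqVlt; apply/orP; left; apply/eqP.
by apply: eq_integral => t _ /=; rewrite ger0_norm// radial_ge0.
Qed.

Lemma integrable_bounded_radial x e D (g : n.-tuple RR -> R) M : 0 < e ->
  measurable D -> D `<=` far x e -> measurable_fun setT g ->
  (forall t, D t -> `|g t| <= M) ->
  mu.-integrable D (EFin \o (fun t => g t * radial s 0 x t)).
Proof.
move=> e0 mD De mg gM.
have ir : mu.-integrable D (EFin \o radial s 0 x).
  exact: (integrableS (measurable_far x e) mD De (integrable_radial_far x e0)).
apply: (le_integrable mD) (integrableZl mD M ir).
  apply/measurable_EFinP/measurable_funTS; apply: measurable_funM => //.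
  exact: measurable_radial.
move=> t /gM h /=; rewrite lee_fin !normrM ler_wpM2r// .
by rewrite (le_trans h)// ler_norm.
Qed.

Lemma Rintegral_le_integral D (f : n.-tuple RR -> R) M :
  (forall t, D t -> 0 <= f t) -> (\int[mu]_(t in D) (f t)%:E <= M%:E)%E ->
  \int[mu]_(t in D) f t <= M.
Proof.
move=> f0 fM; rewrite -lee_fin fineK// ge0_fin_numE.
  exact: le_lt_trans fM (ltry _).
by apply: integral_ge0 => t Dt; rewrite lee_fin f0.
Qed.

Lemma Rintegral_subset D E (f : n.-tuple RR -> R) :
  measurable D -> measurable E -> D `<=` E -> (forall t, E t -> 0 <= f t) ->
  mu.-integrable E (EFin \o f) ->
  \int[mu]_(t in D) f t <= \int[mu]_(t in E) f t.
Proof.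
move=> mD mE DE f0 fi; apply: Rintegral_le_integral => [t /DE/f0//|].
rewrite /Rintegral fineK; last exact: integrable_fin_num.
apply: ge0_subset_integral => //; first exact: (measurable_int mu).
Qed.

Definition paraboloid c (r : R) y : R := 1 - enorm (c - y) ^+ 2 / r ^+ 2.

(** Squaring the positive part makes the function a convex nondecreasing function
    of [paraboloid], differentiable across the sphere. *)
Definition pbump c (r : R) y : R := Num.max 0 (paraboloid c r y) ^+ 2.

Lemma pbump_ge0 c r y : 0 <= pbump c r y. Proof. exact: sqr_ge0. Qed.

Lemma pbump_le1 c r y : pbump c r y <= 1.
Proof.
rewrite /pbump expr_le1// ?le_max ?lexx// ge_max ler01/= /paraboloid.
by rewrite gerBl divr_ge0// sqr_ge0.
Qed.

Lemma pbumpE c r y : 0 <= paraboloid c r y -> pbump c r y = paraboloid c r y ^+ 2.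
Proof. by move=> h; rewrite /pbump; congr (_ ^+ 2); apply/max_idPr. Qed.

Lemma measurable_pbump c r : measurable_fun setT (fun t => pbump c r (row_of_tuple t)).
Proof.
apply: measurable_funX; apply: measurable_maxr; first exact: measurable_cst.
apply: measurable_funB; first exact: measurable_cst.
apply: measurable_funM; last exact: measurable_cst.
by apply: measurable_funX; exact: measurable_dist.
Qed.

Lemma frac_kernel_pbumpE c r x t :
  frac_kernel s (pbump c r) x t =
  (pbump c r x - pbump c r (row_of_tuple t)) * radial s 0 x t.
Proof. by rewrite radial0E. Qed.

Lemma integrable_frac_kernel_pbump c r x e D : 0 < e ->
  measurable D -> D `<=` far x e ->
  mu.-integrable D (EFin \o frac_kernel s (pbump c r) x).
Proof.
move=> e0 mD De.
rewrite (_ : _ \o _ = EFin \o (fun t =>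
   (pbump c r x - pbump c r (row_of_tuple t)) * radial s 0 x t)); last first.
  by apply/funext => t /=; rewrite frac_kernel_pbumpE.
apply: (integrable_bounded_radial (M := 1) e0) => //.
  apply: measurable_funB; [exact: measurable_cst|exact: measurable_pbump].
move=> t _; have := pbump_ge0 c r x; have := pbump_ge0 c r (row_of_tuple t).
have := pbump_le1 c r x; have := pbump_le1 c r (row_of_tuple t).
by rewrite ler_norml => *; lra.
Qed.

(** A convex function lies above its tangents. *)
Lemma sqr_max_tangent (P Q : R) : 0 <= P ->
  Num.max 0 P ^+ 2 - Num.max 0 Q ^+ 2 <= 2 * P * (P - Q).
Proof.
move=> P0; rewrite (max_idPr P0); have [Q0|Q0] := leP 0 Q.
  by have := sqr_ge0 (P - Q); rewrite sqrrB; lra.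
have : 0 <= P * - Q by rewrite mulr_ge0// oppr_ge0 ltW.
by have := sqr_ge0 P; rewrite expr0n/=; lra.
Qed.

(** By [sqr_max_tangent], [phi(x) - phi(y) <= 2 P(x) (P(x) - P(y))], and
    [r^2 (P(x) - P(y)) = l + |x-y|^2], where
    [l = |c-y|^2 - |c-x|^2 - |x-y|^2 = 2 <c-x, x-y>] is odd in [y - x]. The bound is
    uniform in the inner radius [e]. *)
Lemma pbump_near : exists2 C : R, 0 < C & forall c (r : R) x (e rho : R),
  0 < r -> 0 < e -> 0 < rho -> 0 <= paraboloid c r x ->
  \int[mu]_(t in [set t | e < dist x t <= rho]) frac_kernel s (pbump c r) x t <=
  2 * paraboloid c r x / r ^+ 2 * (C * rho `^ (2 - 2 * s)).
Proof.
have [C C0 CP] := near_integral n s01; exists C => // c r x e rho r0 e0 rho0 P0.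
set P := paraboloid c r x in P0 *; set D := [set t | _].
have mD : measurable D by exact: measurable_annulus.
have De : D `<=` far x e by move=> t /andP[].
pose l t := dist c t ^+ 2 - enorm (c - x) ^+ 2 - dist x t ^+ 2.
have ml : measurable_fun setT l.
  apply: measurable_funB; last by apply: measurable_funX; exact: measurable_dist.
  apply: measurable_funB; last exact: measurable_cst.
  by apply: measurable_funX; exact: measurable_dist.
have cxt t : c - row_of_tuple t = (c - x) + (x - row_of_tuple t).
  by rewrite addrA subrK.
have lD t : D t -> `|l t| <= 3 * enorm (c - x) ^+ 2 + 3 * rho ^+ 2.
  move=> /andP[_ dr]; have := enormD_sqr_le (c - x) (x - row_of_tuple t).
  rewrite -cxt -/(dist c t) -/(dist x t) ler_norml /l.
  have : dist x t ^+ 2 <= rho ^+ 2.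
    by rewrite ler_sqr ?nnegrE ?dist_ge0// ltW.
  have := sqr_ge0 (dist c t); have := sqr_ge0 (dist x t).
  have := sqr_ge0 (enorm (c - x)).
  move: (dist c t ^+ 2) (dist x t ^+ 2) (enorm (c - x) ^+ 2) (rho ^+ 2) => *.
  lra.
have il := integrable_bounded_radial e0 mD De ml lD.
have reflE t : row_of_tuple (tuple_reflect (fun i => 2 * x 0 i) t) =
    2 *: x - row_of_tuple t.
  by apply/rowP => i; rewrite !mxE tnth_mktuple.
have dist_refl t : dist x (tuple_reflect (fun i => 2 * x 0 i) t) = dist x t.
  rewrite /dist reflE -enormN; congr enorm.
  by rewrite scaler_nat mulr2n; apply/rowP => i; rewrite !mxE; ring.
(* The parallelogram law says that [l] changes sign without mentioning any inner
   product. *)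
have l_odd t : l (tuple_reflect (fun i => 2 * x 0 i) t) = - l t.
  rewrite /l dist_refl {1}/dist reflE.
  have := enorm_parallelogram (c - x) (x - row_of_tuple t).
  rewrite -cxt -/(dist c t) -/(dist x t).
  rewrite (_ : c - x - (x - row_of_tuple t) = c - (2 *: x - row_of_tuple t)).
    by move=> *; lra.
  by apply/rowP => i; rewrite !mxE; ring.
have lint0 : \int[mu]_(t in D) (l t * radial s 0 x t) = 0.
  apply: (Rintegral_odd (x := x) mD _ _ il).
  - by move=> t; rewrite /D /mkset dist_refl.
  - by apply: measurable_funM => //; exact: measurable_radial.
  - by move=> t; rewrite l_odd /radial dist_refl mulNr.
have radial2E t : radial s 2 x t = dist x t ^+ 2 * radial s 0 x t.
  by rewrite radial0E.
have i2 : mu.-integrable D (EFin \o radial s 2 x).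
  rewrite (_ : _ \o _ = EFin \o (fun t => dist x t ^+ 2 * radial s 0 x t)); last first.
    by apply/funext => t /=; rewrite radial2E.
  apply: (integrable_bounded_radial (M := rho ^+ 2) e0) => //.
    by apply: measurable_funX; exact: measurable_dist.
  move=> t /andP[_ dr]; rewrite ger0_norm ?sqr_ge0//.
  by rewrite ler_sqr ?nnegrE ?dist_ge0// ltW.
have a0 : 0 <= 2 * P / r ^+ 2 by rewrite divr_ge0 ?sqr_ge0// mulr_ge0.
have isum : mu.-integrable D (EFin \o (fun t => l t * radial s 0 x t + radial s 2 x t)).
  exact: (integrableD mD il i2).
apply: (@le_trans _ _ (\int[mu]_(t in D)
    (2 * P / r ^+ 2 * (l t * radial s 0 x t + radial s 2 x t)))).
  apply: le_Rintegral => //.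
  - exact: (integrable_frac_kernel_pbump _ _ e0 mD De).
  - exact: (integrableZl mD (2 * P / r ^+ 2) isum).
  - move=> t Dt; rewrite frac_kernel_pbumpE radial2E -mulrDl mulrA.
    apply: ler_wpM2r; first exact: radial_ge0.
    apply: le_trans (sqr_max_tangent _ P0) _.
    rewrite (_ : P - _ = (l t + dist x t ^+ 2) / r ^+ 2); last first.
      by rewrite /P /paraboloid /l /dist; ring.
    by rewrite le_eqVlt; apply/orP; left; apply/eqP; ring.
rewrite RintegralZl// RintegralD// lint0 add0r ler_wpM2l//.
apply: Rintegral_le_integral => [t _|]; first exact: radial_ge0.
apply: le_trans (CP x rho rho0); apply: ge0_subset_integral => //.
- exact: measurable_annulus.
- by apply/measurable_EFinP/measurable_funTS; exact: measurable_radial.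
- by move=> t _; rewrite lee_fin radial_ge0.
- by move=> t /andP[et tr]; rewrite /= tr (lt_trans e0 et).
Qed.

End bump.

(** * The bump function satisfies an eigenvalue-type inequality *)

Section pbump_estimate.
Variables (R : realType) (n : nat) (s : R).
Hypothesis s01 : 0 < s < 1.
Local Notation mu := (lebesgue_tuple R n).
Local Notation RR := (measurableTypeR R).
Implicit Types (c x y : 'rV[R]_n) (t : n.-tuple RR).

Let s_gt0 : 0 < s. Proof. by case/andP: s01. Qed.
Let s_lt1 : s < 1. Proof. by case/andP: s01. Qed.

(** The gain due to the nonlocality of the operator: what a point [x] receives from
    the values of the bump function at distance more than [rho]. *)
Definition pbump_tail c r x rho : R :=
  \int[mu]_(t in far x rho) (pbump c r (row_of_tuple t) * radial s 0 x t).

Lemma integrable_pbump_tail c r x rho : 0 < rho ->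
  mu.-integrable (far x rho)
    (EFin \o (fun t => pbump c r (row_of_tuple t) * radial s 0 x t)).
Proof.
move=> rho0; apply: (integrable_bounded_radial s01 (M := 1) rho0) => //.
- exact: measurable_far.
- exact: measurable_pbump.
- by move=> t _; rewrite ger0_norm ?pbump_ge0 ?pbump_le1.
Qed.

(** When [x] is close to the sphere, the ball of radius [r/4] around [c] is at
    distance at least [rho] and at most [2r] from [x], and the bump function is at
    least [1/2] there. A cube in that ball of side proportional to [r] therefore
    contributes a multiple of [r^n / r^(n+2s)]. *)
Lemma pbump_tail_ge0 c r x rho : 0 <= pbump_tail c r x rho.
Proof. by apply: Rintegral_ge0 => t _; rewrite mulr_ge0 ?pbump_ge0 ?radial_ge0. Qed.

Lemma pbump_far : exists2 C : R, 0 < C & forall c (r : R) x (rho : R), 0 < rho ->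
  \int[mu]_(t in far x rho) frac_kernel s (pbump c r) x t <=
  pbump c r x * (C * rho `^ (- (2 * s))) - pbump_tail c r x rho.
Proof.
have [C C0 CP] := far_integral n s01; exists C => // c r x rho rho0.
under eq_Rintegral do rewrite frac_kernel_pbumpE mulrBl.
have ir := integrable_radial_far s01 x rho0.
have mf := measurable_far x rho.
rewrite RintegralB//; last 2 first.
- exact: (integrableZl mf (pbump c r x) ir).
- exact: integrable_pbump_tail.
rewrite RintegralZl// lerB// ler_wpM2l ?pbump_ge0//.
by apply: Rintegral_le_integral => [t _|]; [exact: radial_ge0|exact: CP].
Qed.

Lemma pbump_tail_ge : exists2 C : R, 0 < C & forall c (r : R) x (rho : R),
  0 < r -> 0 < rho <= r / 4 -> 0 <= paraboloid c r x < 7 / 16 ->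
  C * r `^ (- (2 * s)) <= pbump_tail c r x rho.
Proof.
(* a cube of half-side [a r] lies in the ball of radius [r/4] *)
pose a : R := (4 * n.+1%:R)^-1.
have a0 : 0 < a by rewrite invr_gt0 mulr_gt0.
pose p := n%:R + 2 * s.
have p0 : 0 < p by rewrite ltr_wpDl// mulr_gt0.
exists (2^-1 * (2 * a) ^+ n / 2 `^ p).
  by rewrite divr_gt0 ?powR_gt0// mulr_gt0 ?invr_gt0// exprn_gt0// mulr_gt0.
move=> c r x rho r0 /andP[rho0 rhor] /andP[P0 P1].
pose Q : set (n.-tuple RR) := [set t | forall i, `|c 0 i - tnth t i| <= a * r].
have mQ : measurable Q by exact: measurable_cube.
have QE : mu Q = ((2 * (a * r)) ^+ n)%:E.
  by rewrite /Q lebesgue_tuple_cube// mulr_ge0 ?ltW.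
have Qfin : (mu Q < +oo)%E by rewrite QE ltry.
have rr : 0 < r ^+ 2 by rewrite exprn_gt0.
have cx : 9 / 16 * r ^+ 2 < enorm (c - x) ^+ 2 <= r ^+ 2.
  move: P0 P1; rewrite /paraboloid subr_ge0 ler_pdivrMr// mul1r => ->.
  by rewrite andbT ltrBlDr -ltrBlDl ltr_pdivlMr// => h; lra.
have dcQ t : Q t -> dist c t ^+ 2 <= r ^+ 2 / 16.
  move=> Qt; rewrite /dist enorm_sqr.
  apply: (@le_trans _ _ (\sum_(i < n) (a * r) ^+ 2)).
    apply: ler_sum => i _; rewrite !mxE -real_normK ?num_real//.
    by rewrite ler_sqr ?nnegrE// ?mulr_ge0 ?ltW.
  rewrite sumr_const card_ord -[leLHS]mulr_natl exprMn
    [leLHS]mulrA [leLHS]mulrC ler_wpM2l ?(ltW rr)//.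
  rewrite exprVn ler_pdivrMr ?exprn_gt0 ?mulr_gt0// exprMn.
  rewrite mulrA (_ : 16^-1 * 4 ^+ 2 = 1 :> R); last by field.
  rewrite mul1r -natrX ler_nat -mulnn.
  by rewrite (leq_trans (leqnSn n))// leq_pmulr.
have dxQ t : Q t -> rho < dist x t <= 2 * r.
  move=> /dcQ dc.
  have h1 := enormD_sqr_le (c - row_of_tuple t) (- (x - row_of_tuple t)).
  have h2 := enormD_sqr_le (c - row_of_tuple t) (- (c - x)).
  rewrite !enormN (_ : _ + _ = c - x) in h1; last first.
    by apply/rowP => i; rewrite !mxE; ring.
  rewrite !enormN (_ : _ + _ = x - row_of_tuple t) in h2; last first.
    by apply/rowP => i; rewrite !mxE; ring.
  rewrite -!/(dist _ _) in h1 h2.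
  have rho2 : rho ^+ 2 <= r ^+ 2 / 16.
    rewrite (_ : r ^+ 2 / 16 = (r / 4) ^+ 2); last by field.
    by rewrite ler_sqr ?nnegrE ?divr_ge0 ?(ltW r0) ?(ltW rho0)//.
  case/andP: cx => cx1 cx2.
  apply/andP; split.
    by rewrite -ltr_sqr ?nnegrE ?dist_ge0 ?(ltW rho0)//; lra.
  by rewrite -ler_sqr ?nnegrE ?dist_ge0 ?mulr_ge0 ?(ltW r0)// exprMn; lra.
have bQ t : Q t -> 2^-1 <= pbump c r (row_of_tuple t).
  move=> /dcQ dc.
  have h : 15 / 16 <= paraboloid c r (row_of_tuple t).
    rewrite /paraboloid -/(dist c t) lerBrDr -lerBrDl ler_pdivrMr//; lra.
  rewrite pbumpE; last by apply: le_trans h; lra.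
  have h0 : 0 <= 15 / 16 :> R by lra.
  apply: (@le_trans _ _ ((15 / 16) ^+ 2)); first by lra.
  by rewrite ler_sqr ?nnegrE// (le_trans h0).
have Qfar : Q `<=` far x rho by move=> t /dxQ/andP[].
apply: (@le_trans _ _ (\int[mu]_(t in Q)
    (pbump c r (row_of_tuple t) * radial s 0 x t))); last first.
  apply: Rintegral_subset => //.
  - exact: measurable_far.
  - by move=> t _; rewrite mulr_ge0 ?pbump_ge0 ?radial_ge0.
  - exact: integrable_pbump_tail.
pose k : R := 2^-1 / (2 * r) `^ p.
apply: (@le_trans _ _ (\int[mu]_(t in Q) k)).
  rewrite Rintegral_cst// (congr1 fine QE : fine _ = _)/= /k powRM ?(ltW r0)//.
  rewrite (_ : r `^ (- (2 * s)) = r ^+ n / r `^ p).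
    by rewrite le_eqVlt; apply/orP; left; apply/eqP; rewrite invfM !exprMn; ring.
  rewrite -powR_mulrn ?(ltW r0)// -powRN -powRD ?(gt_eqF r0) ?implybT//.
  by congr (_ `^ _); rewrite /p; ring.
apply: le_Rintegral => //.
- apply/integrableP; split; first exact/measurable_EFinP.
  rewrite (eq_integral (cst `|k|%:E))//= integral_cst//.
  by apply: lte_mul_pinfty => //; exact: Qfin.
- by apply: (integrableS (measurable_far x rho)) => //; exact: integrable_pbump_tail.
- move=> t Qt; rewrite radial0E; apply: ler_pM; rewrite ?invr_ge0 ?powR_ge0 ?bQ//.
  case/andP: (dxQ t Qt) => d1 d2; have d0 := lt_trans rho0 d1.
  rewrite lef_pV2 ?posrE ?powR_gt0 ?mulr_gt0//.
  by apply: ge0_ler_powR; rewrite ?nnegrE ?dist_ge0 ?mulr_ge0 ?(ltW r0) ?(ltW p0).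
Qed.

(** Below the threshold [P = 7/16] the tail absorbs the near contribution, by the
    choice of [eta]; above it, [P <= (16/7) P^2], so that the near contribution is
    bounded by a multiple of [phi(x)]. *)
Lemma truncated_pbump_le : exists2 C : R, 0 < C & exists2 eta : R, 0 < eta &
  forall c (r : R) x (e : R), 0 < r -> 0 <= paraboloid c r x -> 0 < e <= eta * r ->
  truncated s (pbump c r) x e <= C * r `^ (- (2 * s)) * pbump c r x.
Proof.
have [C1 C10 near] := pbump_near n s01.
have [C2 C20 far_] := pbump_far.
have [c0 c00 tail] := pbump_tail_ge.
pose q := 2 - 2 * s.
have q0 : 0 < q by rewrite subr_gt0 gtr_pMr.
(* [eta <= 1/4] keeps the far region away from the point, as [pbump_tail_ge]
   requires; the other bound makes [2 C1 eta^q <= c0]. *)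
pose eta := Num.min (4^-1) ((c0 / (2 * C1)) `^ q^-1).
have d0 : 0 < c0 / (2 * C1) by rewrite divr_gt0// mulr_gt0.
have eta0 : 0 < eta by rewrite lt_min invr_gt0 ltr0n powR_gt0.
have etaq : C1 * eta `^ q <= c0 / 2.
  have : eta `^ q <= c0 / (2 * C1).
    have -> : c0 / (2 * C1) = ((c0 / (2 * C1)) `^ q^-1) `^ q.
      by rewrite -powRrM mulVf ?(lt0r_neq0 q0)// powRr1// ltW.
    apply: ge0_ler_powR; rewrite ?(ltW q0)// ?nnegrE ?(ltW eta0) ?powR_ge0//.
    by rewrite ge_min lexx orbT.
  rewrite -(ler_pM2l C10) => /le_trans; apply.
  by rewrite le_eqVlt; apply/orP; left; apply/eqP; field; rewrite gt_eqF.
pose B := C2 * eta `^ (- (2 * s)).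
have B0 : 0 < B by rewrite mulr_gt0// powR_gt0.
exists (5 / 2 * c0 + B); first by rewrite addr_gt0// mulr_gt0// divr_gt0.
exists eta => // c r x e r0 P0 /andP[e0 er].
pose rho := eta * r; have rho0 : 0 < rho by rewrite mulr_gt0.
pose X := r `^ (- (2 * s)); have X0 : 0 < X by rewrite powR_gt0.
have farU : far x e = [set t | e < dist x t <= rho] `|` far x rho.
  apply/seteqP; split => t /=.
    by move=> h; have [h'|h'] := leP (dist x t) rho; [left; apply/andP|right].
  by move=> [/andP[]//|]; apply: le_lt_trans.
rewrite /truncated farU Rintegral_setU; last 4 first.
- exact: measurable_annulus.
- exact: measurable_far.
- rewrite -farU; apply: (integrable_frac_kernel_pbump s01 c r e0) => //.
  exact: measurable_far.
- apply/disj_setPS => t /= [/andP[_ h1]] h2.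
  by have := le_lt_trans h1 h2; rewrite ltxx.
apply: le_trans (lerD (near c r x e rho r0 e0 rho0 P0) (far_ c r x rho rho0)) _.
have -> : rho `^ (- (2 * s)) = eta `^ (- (2 * s)) * X by rewrite powRM// ltW.
have -> : rho `^ (2 - 2 * s) = eta `^ q * (r ^+ 2 * X).
  rewrite powRM ?(ltW eta0) ?(ltW r0)//; congr (_ * _).
  by rewrite -powR_mulrn ?(ltW r0)// -powRD// (gt_eqF r0) implybT.
have T0 := pbump_tail_ge0 c r x rho.
have b0 := pbump_ge0 c r x.
have bE := pbumpE P0.
set P := paraboloid c r x in P0 bE *.
rewrite (_ : 2 * P / r ^+ 2 * _ = 2 * P * (C1 * eta `^ q) * X); last first.
  by field; rewrite gt_eqF.
rewrite [pbump c r x * _](_ : _ = pbump c r x * B * X); last by rewrite /B; ring.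
have PA : 2 * P * (C1 * eta `^ q) <= P * c0.
  rewrite (_ : P * c0 = 2 * P * (c0 / 2)); last by field.
  by rewrite ler_wpM2l// mulr_ge0.
have PX : 2 * P * (C1 * eta `^ q) * X <= P * c0 * X by rewrite ler_wpM2r// ltW.
have c0X : 0 < c0 * X by rewrite mulr_gt0.
have [P1|P1] := ltP P (7 / 16).
  have : c0 * X <= pbump_tail c r x rho.
    apply: tail => //; rewrite ?P0//.
    by rewrite rho0 /= /rho (mulrC eta) ler_wpM2l ?(ltW r0)// ge_min lexx.
  have : P * (c0 * X) <= c0 * X by rewrite ler_piMl ?(ltW c0X)//; lra.
  have : 0 <= pbump c r x * (c0 * X) by rewrite mulr_ge0// ltW.
  by rewrite -/X; lra.
have : P * (c0 * X) <= 5 / 2 * P ^+ 2 * (c0 * X).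
  by rewrite ler_wpM2r ?(ltW c0X)//; nra.
by rewrite -bE -/X; lra.
Qed.

End pbump_estimate.

(** * Contact points *)

Section contact.
Variables (R : realType) (n : nat).
Implicit Types (r e : R) (c x y : 'rV[R]_n) (u : 'rV[R]_n -> R).

Lemma continuous_paraboloid c r : continuous (paraboloid c r).
Proof.
have -> : paraboloid c r = (fun y => 1 - enorm (y - c) ^+ 2 / r ^+ 2).
  by apply/funext => y; rewrite /paraboloid -enormN opprB.
move=> y.
have h := @continuous_enorm_sqr R n c y.
exact: (cvgB (cvg_cst (1 : R)) (cvgM h (cvg_cst ((r ^+ 2)^-1 : R)))).
Qed.

Lemma continuous_pbump c r : continuous (pbump c r).
Proof.
move=> y; apply: (@continuous_comp _ _ _ (fun y => Num.max 0 (paraboloid c r y))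
  (fun z : R => z ^+ 2)); last exact: exprn_continuous.
apply: (@continuous_max _ _ (fun=> 0)); first exact: cst_continuous.
exact: continuous_paraboloid.
Qed.

Lemma paraboloid_coord c r y i : 0 < r -> 0 <= paraboloid c r y ->
  `|c 0 i - y 0 i| <= r.
Proof.
move=> r0; rewrite subr_ge0 ler_pdivrMr ?exprn_gt0// mul1r.
rewrite ler_sqr ?nnegrE ?enorm_ge0 ?(ltW r0)//; apply: le_trans.
by apply: le_trans (normr_coord_le_enorm _ i); rewrite !mxE.
Qed.

Lemma compact_paraboloid_ge0 c r : 0 < r ->
  compact [set y | 0 <= paraboloid c r y].
Proof.
move=> r0; apply: bounded_closed_compact.
  exists (r + `|c|); split; first exact: num_real.
  move=> M /ltW rM y /= Py; apply: le_trans rM.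
  rewrite -[y](subrK c); apply: le_trans (ler_normD _ _) _; rewrite lerD2r.
  rewrite [leLHS]/Num.norm/= mx_normrE; apply/bigmax_leP; split; first exact: ltW.
  by move=> [i j] _ /=; rewrite ord1 !mxE distrC; exact: paraboloid_coord.
apply: (@closed_comp _ _ (paraboloid c r) [set z | 0 <= z]).
  by move=> y _; exact: continuous_paraboloid.
exact: closed_ge.
Qed.

(** The point is a maximum of [pbump / u] on the closed ball, where [u] is bounded
    away from [0]; outside the ball the inequality holds since [pbump] vanishes. *)
Lemma exists_contact_point u c r : 0 < r -> continuous u ->
  (forall y, 0 <= u y) -> (forall y, 0 <= paraboloid c r y -> 0 < u y) ->
  exists x, [/\ 0 <= paraboloid c r x, 0 < pbump c r x &
    forall y, pbump c r y * u x <= pbump c r x * u y].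
Proof.
move=> r0 cu u0 upos; set K := [set y | 0 <= paraboloid c r y].
have Pc : paraboloid c r c = 1.
  rewrite /paraboloid subrr (_ : enorm 0 = 0) ?expr0n/= ?mul0r ?subr0//.
  by rewrite /enorm big1 ?sqrtr0// => i _; rewrite mxE expr0n.
have Kc : K c by rewrite /K/= Pc.
have [||x Kx xmax] := @EVT_max_rV R n (fun y => pbump c r y / u y) K _
  (compact_paraboloid_ge0 r0).
- by exists c.
- apply: continuous_in_subspaceT => y /set_mem /upos uy.
  apply: continuousM; first exact: continuous_pbump.
  by apply: continuousV; [rewrite gt_eqF|exact: cu].
move/set_mem : Kx => Kx; have ux := upos _ Kx.
exists x; split => //.
  have := xmax c (mem_set Kc); rewrite pbumpE ?Pc// expr1n.
  have uc := upos _ Kc => h.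
  have : 0 < pbump c r x / u x by apply: lt_le_trans h; rewrite divr_gt0.
  by rewrite pmulr_lgt0// invr_gt0.
move=> y; have [Ky|Ky] := leP 0 (paraboloid c r y).
  have := xmax y (mem_set Ky).
  by rewrite ler_pdivrMr ?upos// mulrAC ler_pdivlMr.
rewrite {1}/pbump (max_idPl (ltW Ky)) expr0n mul0r.
by rewrite mulr_ge0// pbump_ge0.
Qed.

(** [pbump(x) u - u(x) pbump] is nonnegative and vanishes at [x], so that its
    kernel is nonpositive. *)
Lemma truncated_le_at_contact (s : R) u c r x e : 0 < s < 1 -> 0 < e ->
  0 < u x -> 0 < pbump c r x ->
  (forall y, pbump c r y * u x <= pbump c r x * u y) ->
  (lebesgue_tuple R n).-integrable (far x e) (EFin \o frac_kernel s u x) ->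
  pbump c r x * truncated s u x e <= u x * truncated s (pbump c r) x e.
Proof.
move=> s01 e0 ux bx ub iu; have mf := measurable_far x e.
have ib := integrable_frac_kernel_pbump s01 c r e0 mf (@subset_refl _ _).
rewrite /truncated -!RintegralZl//; apply: le_Rintegral => //.
- exact: (integrableZl mf (pbump c r x) iu).
- exact: (integrableZl mf (u x) ib).
move=> t _; rewrite /frac_kernel !mulrA ler_wpM2r ?invr_ge0 ?powR_ge0//.
rewrite !mulrBr (mulrC (u x)) lerB// mulrC; exact: ub.
Qed.

End contact.

Section frac_laplacian_of_positive_functions.
Variables (R : realType) (n : nat) (s : R).
Hypothesis s01 : 0 < s < 1.

Lemma cNs_ge0 : 0 <= cNs n s.
Proof.
have [s0 s1] := andP s01.
have G0 (z : R) : 0 <= Gamma z.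
  by apply: Rintegral_ge0 => t _; rewrite mulr_ge0 ?powR_ge0 ?expR_ge0.
rewrite /cNs !mulr_ge0 ?powR_ge0 ?invr_ge0 ?subr_ge0 ?G0//; exact: ltW.
Qed.

(** A pointwise form of the upper bound [C r^(-2s)] for the first eigenvalue of a
    ball. *)
Lemma exists_small_frac_laplacian : exists2 C : R, 0 < C &
  forall (r : R) (c : 'rV[R]_n) (u : 'rV[R]_n -> R), 0 < r -> continuous u ->
  (forall y, 0 <= u y) -> (forall y, 0 <= paraboloid c r y -> 0 < u y) ->
  (forall y, 0 <= paraboloid c r y -> frac_laplacian_defined s u y) ->
  exists2 x, 0 <= paraboloid c r x &
    frac_laplacian s u x <= C * r `^ (- (2 * s)) * u x.
Proof.
have [C C0 [eta eta0 CP]] := truncated_pbump_le n s01.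
(* The [+ 1] makes the constant positive from [0 <= cNs] alone. *)
exists (cNs n s * C + 1); first by rewrite ltr_wpDl// mulr_ge0 ?cNs_ge0// ltW.
move=> r c u r0 cu u0 upos udef.
have [x [Px bx ub]] := exists_contact_point r0 cu u0 upos.
have ux := upos _ Px; have [iu cvu] := udef _ Px.
exists x => //; set X := r `^ _; have X0 : 0 <= X by exact: powR_ge0.
apply: (@le_trans _ _ (cNs n s * (C * X * u x))); last first.
  rewrite mulrDl mulrDl mul1r -!mulrA lerDl mulr_ge0// ltW//.
rewrite /frac_laplacian ler_wpM2l ?cNs_ge0//.
apply: limr_le => //; near=> e.
have e0 : 0 < e by near: e; exact: nbhs_right_gt.
have er : e <= eta * r by near: e; apply: nbhs_right_le; rewrite mulr_gt0.
rewrite -(ler_pM2l bx).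
apply: le_trans (truncated_le_at_contact s01 e0 ux bx ub (iu e e0)) _.
rewrite [leRHS](_ : _ = u x * (C * X * pbump c r x)); last by ring.
by rewrite ler_wpM2l ?(ltW ux)// CP// e0.
Unshelve. all: by end_near.
Qed.

End frac_laplacian_of_positive_functions.

(** * The nonlinearity and the conclusion *)

Section nonlinearity.
Variables (R : realType) (f : R -> R).

Lemma limf_einf_gt0_near (F : set_system R) (g : R -> R) : Filter F ->
  (0 < limf_einf (fun t => (g t)%:E) F)%E ->
  exists2 l : R, 0 < l & \forall t \near F, l <= g t.
Proof.
move=> FF; rewrite /limf_einf oppe_gt0 => /ereal_inf_lt[_ [V FV <-]] supV.
have [l l0 supl] : exists2 l : R, 0 < l &
    (ereal_sup ((\- (fun t => (g t)%:E)) @` V) <= (- l)%:E)%E.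
  case: (ereal_sup _) supV => [r| |]//=.
    by rewrite lte_fin => r0; exists (- r); rewrite ?oppr_gt0// opprK.
  by move=> _; exists 1; rewrite ?leNye.
exists l => //; apply: filterS FV => t Vt; rewrite -lerN2 -lee_fin.
by apply: le_trans supl; apply: ereal_sup_ubound; exists t.
Qed.

Lemma locally_lipschitz_continuous :
  (forall t : R, exists2 V, nbhs t V & [lipschitz f z | z in V]) ->
  continuous f.
Proof.
move=> lip t; have [V Vt lV] := lip t.
have [k k0 kV] : exists2 k : R, 0 < k &
    forall y z, V y -> V z -> `|f y - f z| <= k * `|y - z|.
  have [k [k0 kV]] := pinfty_ex_gt0 lV; exists k => // y z Vy Vz.
  by have := kV (y, z); apply.
apply/cvgrPdist_le => e e0; near=> z.
apply: le_trans (kV t z _ _) _; [exact: nbhs_singleton|by near: z|].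
rewrite mulrC -ler_pdivlMr//; near: z.
apply: cvgr_dist_le => //; rewrite divr_gt0//.
Unshelve. all: by end_near.
Qed.

(** Near [0] the bound is the hypothesis on the lower limit; on the remaining
    compact interval [f] has a positive minimum [f z], and [t / M <= 1]. *)
Lemma linear_lower_bound (M : R) : continuous f ->
  (forall t : R, 0 < t -> 0 < f t) ->
  (0 < limf_einf (fun t : R => (f t / t)%:E) (0 : R)^'+)%E ->
  exists2 l : R, 0 < l & forall t, 0 < t <= M -> l * t <= f t.
Proof.
move=> cf fpos /limf_einf_gt0_near[l l0 nl].
have [d d0 dl] : exists2 d : R, 0 < d & forall t, 0 < t < d -> l <= f t / t.
  move: nl => /nbhs_ballP[d /= d0 dl]; exists d => // t /andP[t0 td].
  by apply: dl => //=; rewrite /ball/= sub0r normrN gtr0_norm.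
have small t : 0 < t < d -> l * t <= f t.
  by move=> td; have := dl t td; case/andP: td => t0 _; rewrite ler_pdivlMr.
have [dM|Md] := leP d M; last first.
  exists l => // t /andP[t0 tM]; apply: small; rewrite t0/=; exact: le_lt_trans Md.
have [z zdM zmin] := EVT_min dM (continuous_subspaceT cf).
have z0 : 0 < z by move: zdM; rewrite in_itv/= => /andP[+ _]; exact: lt_le_trans.
have M0 : 0 < M by exact: lt_le_trans dM.
exists (Num.min l (f z / M)); first by rewrite lt_min l0 divr_gt0 ?fpos.
move=> t /andP[t0 tM]; have [td|dt] := ltP t d.
  apply: le_trans (small t _); last by rewrite t0.
  by rewrite ler_wpM2r ?(ltW t0)// ge_min lexx.
apply: (@le_trans _ _ (f z / M * t)).
  by rewrite ler_wpM2r ?(ltW t0)// ge_min lexx orbT.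
apply: (@le_trans _ _ (f z)); last by apply: zmin; rewrite in_itv/= dt.
by rewrite mulrAC ler_pdivrMr// ler_wpM2l// ltW// fpos.
Qed.

End nonlinearity.

Theorem corollary1 (R : realType) (s : R) (n : nat) (f : R -> R)
    (hs : 0 < s < 1)
    (f_lip : forall t : R, exists2 V, nbhs t V & [lipschitz f z | z in V])
    (f_pos : forall t : R, 0 < t -> 0 < f t)
    (f_liminf : (0 < limf_einf (fun t : R => (f t / t)%:E) (0 : R)^'+)%E) :
  ~ exists u : 'rV[R]_n.+1 -> R,
      positive_solution s f u /\ [bounded u x | x in [set: 'rV[R]_n.+1]].
Proof.
move=> [u [[[cu _ eq_u out_u] pos_u] bu]].
have [M _ uM] := pinfty_ex_gt0 bu.
have cf := locally_lipschitz_continuous f_lip.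
have [l l0 fl] := linear_lower_bound M cf f_pos f_liminf.
have [C C0 CP] := exists_small_frac_laplacian n.+1 hs.
have s0 : 0 < s by case/andP: hs.
(* the radius is chosen so that [C r^(-2s) = l / 2] *)
pose y := l / (2 * C); have y0 : 0 < y by rewrite divr_gt0// mulr_gt0.
pose r := y `^ (- (2 * s)^-1); have r0 : 0 < r by exact: powR_gt0.
(* the ball of radius [r] around a point of height [2 r] has its closure in the
   half-space *)
pose c : 'rV[R]_n.+1 := (2 * r) *: delta_mx 0 ord_max.
have in_half z : 0 <= paraboloid c r z -> half_space R n z.
  move=> /(paraboloid_coord ord_max r0).
  by rewrite /half_space/= !mxE !eqxx/= mulr1 ler_norml => /andP[_]; lra.
have u0 z : 0 <= u z.
  by have [/pos_u/ltW//|/out_u->] := pselect (half_space R n z).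
have [x Px] := CP r c u r0 cu u0 (fun z Pz => pos_u z (in_half z Pz))
  (fun z Pz => (eq_u z (in_half z Pz)).1).
have [_ ->] := eq_u x (in_half x Px).
have ux := pos_u x (in_half x Px).
have : l * u x <= f (u x).
  by apply: fl; rewrite ux/=; apply: le_trans (uM x I); rewrite ler_norm.
have -> : r `^ (- (2 * s)) = y.
  rewrite /r -powRrM mulrNN mulVf ?powRr1 ?(ltW y0)//.
  by rewrite mulf_neq0// gt_eqF.
move=> h1 h2; have := le_trans h1 h2; rewrite ler_pM2r//.
rewrite /y (_ : C * _ = l / 2); first lra.
by field; rewrite gt_eqF.
Qed.
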